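(* Let $\Gamma$ be a countable group and let $F \subseteq \Gamma$ be a finite set. If $\Gamma \curvearrowright X$ is a free Borel action on a standard Borel space $X$, then $$\chi^\ast_{\mathrm{B}}(G(X,F)) \;\leq\; \frac{1}{\alpha_\beta(G(\mathrm{Free}(2^{\Gamma}), F))}.$$ In particular, $$\chi^\ast_{\mathrm{B}}(G(\mathrm{Free}(2^{\Gamma}), F)) \;=\; \frac{1}{\alpha_\beta(G(\mathrm{Free}(2^{\Gamma}), F))}.$$
   Context: All graphs are undirected and simple. A graph $G$ is Borel if $V(G)$ is a standard Borel space and $E(G)$ is a Borel subset of $V(G)\times V(G)$. A set $I \subseteq V(G)$ is $G$-independent if no two vertices in $I$ are adjacent in $G$. For $k \geq 1$, the Borel $k$-fold chromatic number $\chi^k_{\mathrm{B}}(G)$ is the least $\ell \in \mathbb{N}$ such that there are Borel $G$-independent sets $I_1,\ldots,I_\ell$ (not necessarily distinct) that cover every vertex of $G$ at least $k$ times, i.e., every $x \in V(G)$ belongs to $I_i$ for at least $k$ indices $i$ ($\chi^k_{\mathrm{B}}(G) = \infty$ if no such $\ell$ exists). The Borel fractional chromatic number is $\chi^\ast_{\mathrm{B}}(G) = \inf_{k\geq 1} \chi^k_{\mathrm{B}}(G)/k$. For a probability Borel measure $\mu$ on $V(G)$, the $\mu$-independence number is $\alpha_\mu(G) = \sup_I \mu(I)$, the supremum being over all $\mu$-measurable $G$-independent sets $I \subseteq V(G)$. Given a Borel action $\Gamma \curvearrowright X$ of a countable group on a standard Borel space and a finite set $F \subseteq \Gamma$, the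 Schreier graph $G(X,F)$ has vertex set $X$, with two distinct points $x,y\in X$ adjacent iff $y = \sigma\cdot x$ for some $\sigma \in F\cup F^{-1}$. The action is free if $\gamma\cdot x\neq x$ for all $x\in X$ and all non-identity $\gamma\in\Gamma$. The Bernoulli shift $\Gamma \curvearrowright 2^\Gamma$ (where $2=\{0,1\}$) is given by $(\gamma\cdot x)(\delta) = x(\delta\gamma)$ for $x\colon\Gamma\to 2$ and $\gamma,\delta\in\Gamma$. $\mathrm{Free}(2^\Gamma)$ is the set of all $x\in 2^\Gamma$ with trivial stabilizer under the shift, with the induced action. $\beta$ is the ''coin flip'' probability measure on $2^\Gamma$, obtained as the product of countably many copies of the uniform probability measure on $\{0,1\}$; it is taken as given that the shift action is free $\beta$-almost everywhere, i.e., $\beta(\mathrm{Free}(2^\Gamma))=1$, so that $\beta$ is regarded as a probability measure on $\mathrm{Free}(2^\Gamma)$. *)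

(* Defs.v *)
From HB Require Import structures.
From mathcomp Require Import all_boot all_order all_algebra.
From mathcomp Require Import all_classical all_reals all_analysis.

Set Implicit Arguments.
Unset Strict Implicit.
Unset Printing Implicit Defensive.

Import Order.TTheory GRing.Theory Num.Theory.

Local Open Scope classical_set_scope.
Local Open Scope ring_scope.

Definition polish (R : realType) (Y : metricType R) : Prop :=
  (exists2 D : set Y, countable D & dense D) /\
  (forall F : set_system Y, ProperFilter F -> cauchy F ->
     exists y : Y, F --> y).

(* The measurable sets of T are the Borel sets of some Polish topology; the
   Polish space is a separate type Y, transported along a bijection. *)
Definition standard_borel (R : realType) d (T : measurableType d) : Prop :=
  exists Y : metricType R, polish Y /\
  exists2 f : T -> Y, bijective f &
    forall A : set T, measurable A <->
      exists2 B : set Y, <<s @open Y >> B & A = f @^-1` B.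

(* A graph whose vertex set is a subset of the ambient type T. Below, T is a
   measurable type and the vertex set is measurable in T, so the Borel subsets
   of the vertex set are the measurable sets of T contained in it. The relation
   [adj] only matters on [vertices]. *)
Record graph (T : Type) := Graph {
  vertices : set T ;
  adj : T -> T -> Prop
}.

Definition independent (T : Type) (G : graph T) (I : set T) : Prop :=
  I `<=` vertices G /\ forall x y, I x -> I y -> ~ adj G x y.

Section chromatic.
Context (R : realType) d (T : measurableType d) (G : graph T).
Local Open Scope ereal_scope.

Definition kfold_colorable (k l : nat) : Prop :=
  exists I : 'I_l -> set T,
    [/\ forall i, measurable (I i),
        forall i, independent G (I i) &
        forall x, vertices G x -> (k <= #|[pred i | x \in I i]|)%N].

(* The infimum of a set of natural numbers in \bar R: its least element, or
   +oo if it is empty. *)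
Definition borel_kfold_chromatic (k : nat) : \bar R :=
  ereal_inf [set l%:R%:E | l in [set l : nat | kfold_colorable k l]].

Definition borel_fractional_chromatic : \bar R :=
  ereal_inf [set borel_kfold_chromatic k / k%:R%:E
            | k in [set k : nat | (1 <= k)%N]].

End chromatic.

Section independence_number.
Context (R : realType) d (T : measurableType d).
Variable mu : {measure set T -> \bar R}.
Local Open Scope ereal_scope.

(* Measurability with respect to the completion of mu. *)
Definition mu_measurable (I : set T) : Prop :=
  exists2 A : set T, measurable A & mu.-negligible (A `+` I).

(* mu^* is the outer measure of mu, which agrees with the completion of mu on
   mu-measurable sets. *)
Definition independence_number (G : graph T) : \bar R :=
  ereal_sup [set (mu^*)%mu I
            | I in [set I : set T | mu_measurable I /\ independent G I]].

End independence_number.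

Section actions.
Variable Γ : groupType.

(* A Borel action of the countable (discrete) group Γ on the measurable subset
   X of T; the values of [act] outside X are irrelevant. *)
Definition borel_action d (T : measurableType d) (X : set T)
    (act : Γ -> T -> T) : Prop :=
  [/\ forall γ x, X x -> X (act γ x),
      forall x, X x -> act 1%g x = x,
      forall γ δ x, X x -> act (γ * δ)%g x = act γ (act δ x) &
      forall γ, measurable_fun X (act γ)].

Definition free_action (T : Type) (X : set T) (act : Γ -> T -> T) : Prop :=
  forall γ x, X x -> act γ x = x -> γ = 1%g.

Definition schreier (T : Type) (act : Γ -> T -> T) (X : set T) (F : set Γ) :
    graph T :=
  Graph X (fun x y => x <> y /\
    exists2 σ, (F `|` [set τ^-1%g | τ in F]) σ & y = act σ x).

(* 2^Γ with the product σ-algebra, generated by the coordinate maps. *)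
Definition coordinate_sets : set (set (Γ -> bool)) :=
  [set A | exists γ b, A = [set x | x γ = b]].

Definition pow2 : measurableType _ := g_sigma_algebraType coordinate_sets.

Definition bernoulli_shift (γ : Γ) (x : pow2) : pow2 := fun δ => x (δ * γ)%g.

Definition free_part : set pow2 :=
  [set x | forall γ, bernoulli_shift γ x = x -> γ = 1%g].

(* The product of the uniform measures on {0,1}: every finite set of
   coordinates is uniformly distributed. This determines beta. *)
Definition coin_flip (R : realType) (beta : probability pow2 R) : Prop :=
  forall (s : seq Γ) (p : Γ -> bool), uniq s ->
    beta [set x : pow2 | {in s, forall γ, x γ = p γ}] =
    ((2^-1 : R) ^+ size s)%:E.

End actions.

Arguments free_part : clear implicits.

(* Main.v *)
(** An independent set of nearly maximal measure can be replaced by a set E that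
  depends on finitely many coordinates s only and whose translates by the
  generators are disjoint from it everywhere, not just almost everywhere. Given
  a free Borel action on X, color X with finitely many colors, in a Borel way,
  so that the points γ·x, γ in s, get distinct colors for every x. Any 2-coloring
  h of the set of colors then yields an equivariant map X -> 2^Γ, and the
  pullback of E is independent. When h ranges over all 2-colorings, the
  restriction to s of the image of a fixed x is equidistributed, so these
  pullbacks cover x the same number of times, a proportion β(E) of them. The
  reverse inequality follows by integrating the number of sets that cover a
  point. *)

Require Import Defs.
From HB Require Import structures.
From mathcomp Require Import all_boot all_order all_algebra.
From mathcomp Require Import all_classical all_reals all_analysis.
From mathcomp Require Import measurable_realfun.

Set Implicit Arguments.
Unset Strict Implicit.
Unset Printing Implicit Defensive.

Import Order.TTheory GRing.Theory Num.Theory.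

Local Open Scope classical_set_scope.
Local Open Scope ring_scope.
Local Open Scope ereal_scope.

(** * Borel colorings *)

(** A countable measurable family of this kind is the form in which the standard Borel hypothesis
    enters the coloring argument. *)
Definition point_separating (J T : Type) (U : J -> set T) : Prop :=
  forall x y, x <> y -> exists2 j, U j x & ~ U j y.

Section borel_coloring.
Context d (T : measurableType d) (Γ : groupType) (X : set T).
Context (act : Γ -> T -> T).
Hypotheses (mX : measurable X) (actP : borel_action X act).
Hypothesis act_free : free_action X act.
Context (J : countType) (U : J -> set T).
Hypotheses (mU : forall j, measurable (U j)) (sepU : point_separating U).

Let actX γ x : X x -> X (act γ x). Proof. by case: actP => + _ _ _; exact. Qed.

Let act1 x : X x -> act 1%g x = x. Proof. by case: actP => _ + _ _; exact. Qed.

Let actM γ δ x : X x -> act (γ * δ)%g x = act γ (act δ x).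
Proof. by case: actP => _ _ + _; exact. Qed.

Let actK γ x : X x -> act γ^-1%g (act γ x) = x.
Proof. by move=> Xx; rewrite -actM// mulVg act1. Qed.

Let measurable_act γ A : measurable A -> measurable (X `&` act γ @^-1` A).
Proof. by case: actP => _ _ _ + mA; exact. Qed.

Section symmetric_generators.
Context (S : seq Γ).
Hypothesis S1 : 1%g \notin S.
Hypothesis SV : forall σ, σ \in S -> σ^-1%g \in S.

(* Finite intersections of the separating sets separate a point from its
   finitely many neighbors. *)
Let V (l : seq J) : set T := X `&` (\bigcap_(j in [set` l]) U j) `&`
  \bigcap_(σ in [set` S]) (X `&` act σ @^-1` ~` \bigcap_(j in [set` l]) U j).

Let mV l : measurable (V l).
Proof.
have mUl : measurable (\bigcap_(j in [set` l]) U j).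
  by apply: fin_bigcap_measurable => //; exact: finite_seq.
apply: measurableI; first exact: measurableI.
apply: fin_bigcap_measurable; first exact: finite_seq.
by move=> σ _; apply: measurable_act; exact: measurableC.
Qed.

Let V_cover x : X x -> exists l, V l x.
Proof.
move=> Xx.
have /choice[e eP] : forall σ, exists l : seq J, (forall j, j \in l -> U j x) /\
    (σ \in S -> exists2 j, j \in l & ~ U j (act σ x)).
  move=> σ; case: (boolP (σ \in S)) => [σS|_]; last by exists [::].
  have [|j Ujx Ujσx] := sepU (x := x) (y := act σ x).
    by move=> /esym/(act_free Xx) σ1; move: σS; rewrite σ1 (negPf S1).
  by exists [:: j]; split=> [i|_]; [rewrite inE => /eqP-> | exists j; rewrite ?inE].
exists (flatten [seq e σ | σ <- S]); split; first split => //.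
- by move=> j /= /flatten_mapP[σ _]; have [+ _] := eP σ; exact.
- move=> σ /= σS; split => /=; first exact: Xx.
  have [_ /(_ σS)[j je Ujσx]] := eP σ.
  by move=> Vσx; apply/Ujσx/Vσx; apply/flatten_mapP; exists σ.
Qed.

Let V_indep l x σ : V l x -> σ \in S -> ~ V l (act σ x).
Proof. by move=> [_ /(_ σ) Vx] /Vx[_ NV] [[_ /NV]]. Qed.

(** Countably many sets [V l] cover [X], and none contains both a point and one of its neighbors.
    Going through them in order and adding the points of [Z] that have no neighbor chosen so far
    keeps the set independent and omits only points with a chosen neighbor. *)
Lemma borel_maximal_independent (Z : set T) : measurable Z -> Z `<=` X ->
  exists A, [/\ measurable A, A `<=` Z,
    forall x σ, A x -> σ \in S -> ~ A (act σ x) &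
    forall x, Z x -> A x \/ exists2 σ, σ \in S & A (act σ x)].
Proof.
move=> mZ ZX.
pose W n := if unpickle n is Some l then V l else set0.
pose B := fix B n := if n is m.+1 then
  B m `|` (W m `&` Z `&` \bigcap_(σ in [set` S]) ~` (X `&` act σ @^-1` B m))
  else set0.
have mW n : measurable (W n) by rewrite /W; case: unpickle.
have mB n : measurable (B n).
  elim: n => //= n mBn; apply: measurableU => //.
  apply: measurableI; first exact: measurableI.
  apply: fin_bigcap_measurable; first exact: finite_seq.
  by move=> σ _; apply: measurableC; exact: measurable_act.
have BZ n : B n `<=` Z.
  by elim: n => //= n BnZ x [/BnZ//|[[_ ?] _]].
have BS m n : (m <= n)%N -> B m `<=` B n.
  move=> /subnK <-; elim: (n - m)%N => //= k BmBk x Bmx.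
  by left; exact: BmBk.
have B_indep n x σ : B n x -> σ \in S -> ~ B n (act σ x).
  move=> + σS; elim: n => //= n IHn [Bx|[[Wx Zx] Nx]] [Bσx|[[Wσx _] Nσx]].
  - exact: IHn Bx Bσx.
  (* An old point with a new neighbor: by symmetry of [S] the old point is the translate of the new
     one by [σ^-1]. *)
  - have /= := Nσx _ (SV σS); apply; split; first exact/actX/ZX/(BZ n).
    by rewrite actK//; exact/ZX/(BZ n).
  - by have /= := Nx _ σS; apply; split => //; exact: ZX.
  - move: Wx Wσx; rewrite /W; case: unpickle => // l Vx.
    exact: V_indep Vx σS.
exists (\bigcup_n B n); split.
- exact: bigcupT_measurable.
- by move=> x [n _ /BZ].
- move=> x σ [m _ Bx] σS [n _ Bσx].
  apply: (B_indep (maxn m n) x σ _ σS).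
  + exact: (BS _ _ (leq_maxl m n)).
  + exact: (BS _ _ (leq_maxr m n)).
- move=> x Zx; have [l Vlx] := V_cover (ZX _ Zx).
  apply: contrapT => /not_orP[NA Nσ].
  have Bx : B (pickle l).+1 x.
    right; split; first by split; rewrite // /W pickleK.
    move=> σ /= σS [_ Bσx]; apply: Nσ; exists σ => //.
    by exists (pickle l).
  by apply: NA; exists (pickle l).+1.
Qed.

(** Greedy coloring, one color class per round. A point left over after [size S + 1] rounds would
    see that many distinct colors among at most [size S] neighbors. *)
Lemma borel_proper_coloring : exists c : T -> nat,
  [/\ forall j, measurable (X `&` c @^-1` [set j]),
      forall x, X x -> (c x <= size S)%N &
      forall x σ, X x -> σ \in S -> c (act σ x) <> c x].
Proof.
(* After [N] rounds the colors below [N] are final, and [N] marks the points still waiting, each of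
   which has neighbors of all final colors. *)
suff /(_ (size S).+1)[c [mc cle cS cmax]] N : exists c : T -> nat,
    [/\ forall j, measurable (X `&` c @^-1` [set j]),
        forall x, X x -> (c x <= N)%N,
        forall x σ, X x -> σ \in S -> (c x < N)%N -> c (act σ x) <> c x &
        forall x, X x -> c x = N ->
          forall i, (i < N)%N -> exists2 σ, σ \in S & c (act σ x) = i].
  have cltS x : X x -> (c x < (size S).+1)%N.
    move=> Xx; rewrite ltn_neqAle cle// andbT; apply/eqP => cx.
    suff : (size (iota 0 (size S).+1) <= size [seq c (act σ x) | σ <- S])%N.
      by rewrite size_iota size_map ltnn.
    apply: uniq_leq_size; first exact: iota_uniq.
    move=> i; rewrite mem_iota add0n => /= iS.
    by have [σ σS <-] := cmax x Xx cx i iS; exact: map_f.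
  exists c; split=> // x σ Xx σS; exact: cS (cltS _ _).
elim: N => [|N [c [mc cle cS cmax]]].
  exists (fun=> 0%N); split=> // j.
  have [->|j0] := eqVneq j 0%N.
    by rewrite (_ : _ @^-1` _ = setT) ?setIT//; apply/seteqP; split.
  rewrite (_ : _ @^-1` _ = set0) ?setI0//; apply/seteqP; split=> //= x /= E.
  by move: j0; rewrite -E.
(* A maximal independent set [A] of waiting points keeps the color [N]; the rest, [D], moves on to
   [N.+1]. *)
have [A [mA AZ A_indep A_max]] :=
  borel_maximal_independent (mc N) (@subIsetl _ _ _).
pose D := (X `&` c @^-1` [set N]) `\` A.
have mD : measurable D by exact: measurableD.
pose c' x := if x \in D then N.+1 else c x.
have c'D x : D x -> c' x = N.+1 by move=> Dx; rewrite /c' mem_set.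
have c'ND x : ~ D x -> c' x = c x by move=> Dx; rewrite /c' memNset.
have AND x : A x -> ~ D x by move=> Ax [].
have c'A x : A x -> c' x = N.
  by move=> Ax; rewrite c'ND; [have [] := AZ _ Ax|exact: AND].
have c'N x : X x -> c' x = N -> A x.
  move=> Xx; have [Dx|Dx] := pselect (D x); first by rewrite c'D// => /esym/n_Sn.
  by rewrite c'ND// => cx; apply: contrapT => Ax; exact: Dx.
have c'lt x : X x -> (c x < N)%N -> c' x = c x.
  by move=> Xx cx; rewrite c'ND// => -[[_ /= cN]]; move: cx; rewrite cN ltnn.
have c'case x : X x -> (c' x < N.+1)%N -> (c x < N)%N \/ A x.
  move=> Xx; have [Dx|Dx] := pselect (D x); first by rewrite c'D// ltnn.
  rewrite c'ND// ltnS leq_eqVlt => /orP[/eqP cx|->]; last by left.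
  by right; apply: c'N => //; rewrite c'ND.
exists c'; split.
- move=> j.
  have -> : X `&` c' @^-1` [set j] = (X `&` c @^-1` [set j]) `\` D `|`
      (if j == N.+1 then D else set0).
    apply/seteqP; split=> x.
      move=> [Xx /=]; have [Dx|Dx] := pselect (D x).
        by rewrite c'D// => <-; rewrite eqxx; right.
      by rewrite c'ND// => cx; left.
    case=> [[[Xx /= cx] Dx]|]; first by split=> //=; rewrite c'ND.
    by case: eqP => // -> Dx; split; [case: Dx => -[]|exact: c'D].
  apply: measurableU; last by case: ifP.
  exact: measurableD.
- move=> x Xx; have [Dx|Dx] := pselect (D x); first by rewrite c'D.
  by rewrite c'ND// (leq_trans (cle _ Xx)).
- move=> x σ Xx σS /(c'case _ Xx)[cx|Ax].
    rewrite (c'lt x)//; have [Dx|Dx] := pselect (D (act σ x)).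
      by rewrite c'D// => E; move: cx; rewrite -E ltnNge leqnSn.
    by rewrite c'ND//; exact: cS.
  by rewrite (c'A x)// => /(c'N _ (actX _ Xx)); exact: A_indep Ax σS.
- move=> x Xx c'x i; have Dx : D x.
    apply: contrapT => Dx; move: c'x; rewrite c'ND// => cx.
    by have := cle _ Xx; rewrite cx ltnn.
  have [[_ cx] NAx] := Dx.
  rewrite ltnS leq_eqVlt => /orP[/eqP ->|iN].
    have [//|[σ σS Aσx]] := A_max x (conj Xx cx).
    by exists σ => //; exact: c'A.
  have [σ σS cσx] := cmax x Xx cx i iN; exists σ => //.
  by rewrite c'lt ?cσx//; exact: actX.
Qed.

End symmetric_generators.

(** Since γ·x = (γδ⁻¹)·(δ·x), it is enough that the coloring be proper for the nontrivial quotients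
    γδ⁻¹ of elements of [s]. *)
Lemma borel_coloring_injective (s : seq Γ) : exists (N : nat) (c : T -> nat),
  [/\ forall j, measurable (X `&` c @^-1` [set j]),
      forall x, X x -> (c x < N)%N &
      forall x, X x -> {in s &, injective (fun γ => c (act γ x))}].
Proof.
pose S := [seq σ <- [seq (γ * δ^-1)%g | γ <- s, δ <- s] | σ != 1%g].
have S1 : 1%g \notin S by rewrite mem_filter eqxx.
have SV σ : σ \in S -> σ^-1%g \in S.
  rewrite !mem_filter => /andP[σ1 /allpairsP[[γ δ] /= [γs δs E]]].
  rewrite invg_eq1 σ1/=; apply/allpairsP; exists (δ, γ); split=> //=.
  by rewrite E invgF.
have [c [mc cle cS]] := borel_proper_coloring S1 SV.
exists (size S).+1, c; split=> // x Xx γ δ γs δs E.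
apply: contrapT => γδ; apply: (cS (act δ x) (γ * δ^-1)%g).
- exact: actX.
- rewrite mem_filter; apply/andP; split.
    by apply/eqP => /divg1_eq.
  by apply/allpairsP; exists (γ, δ).
- by rewrite -actM ?mulgVK//; exact: actX.
Qed.

End borel_coloring.

(** * Sets determined by finitely many coordinates *)

(** All fibers of h ↦ h ∘ k have the same size: adding modulo 2 an extension of [p] along [k]
    exchanges the fiber over [p] with the fiber over 0. *)
Lemma card_ffun_precomp (A B : finType) (k : A -> B)
    (Q : pred {ffun A -> bool}) : injective k ->
  (#|[pred h : {ffun B -> bool} | Q [ffun a => h (k a)]]| * 2 ^ #|A| =
   #|Q| * 2 ^ #|B|)%N.
Proof.
move=> kI; pose res (h : {ffun B -> bool}) : {ffun A -> bool} := [ffun a => h (k a)].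
pose lft (p : {ffun A -> bool}) b :=
  if [pick a | k a == b] is Some a then p a else false.
have lftK p a : lft p (k a) = p a.
  by rewrite /lft; case: pickP => [a' /eqP/kI ->//|/(_ a)]; rewrite eqxx.
pose fib p := #|[set h | res h == p]%SET|.
have fibE p : fib p = fib [ffun=> false].
  pose f (h : {ffun B -> bool}) : {ffun B -> bool} := [ffun b => h b (+) lft p b].
  have fK : involutive f by move=> h; apply/ffunP => b; rewrite !ffunE addbK.
  rewrite /fib -(on_card_preimset (f := f)); last by exists f => ? _; exact: fK.
  apply: eq_card => h; rewrite !inE; apply/eqP/eqP => /ffunP E; apply/ffunP => a.
    by have := E a; rewrite !ffunE lftK => /(canRL (addbK _)) ->; rewrite addbb.
  by have := E a; rewrite !ffunE lftK => ->.
have cardE P : #|[pred h | P (res h)]| = (#|P| * fib [ffun=> false])%N.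
  rewrite -sum1_card (partition_big res P)//= -sum_nat_const.
  apply: eq_bigr => p Pp; rewrite -(fibE p) /fib -sum1_card; apply: eq_bigl => h.
  by rewrite !inE andb_idl// => /eqP ->.
(* Taking for [P] the full predicate computes the common fiber size. *)
have -> : (2 ^ #|B| = 2 ^ #|A| * fib [ffun=> false])%N.
  by rewrite -!card_bool -!card_ffun -cardE.
by rewrite cardE mulnAC mulnA.
Qed.

Section patterns.
Variable Γ : groupType.

(** These are clopen sets of the product topology. One implication is enough, as [x] and [y] can be
    swapped. *)
Definition determined_by (s : seq Γ) (C : set (pow2 Γ)) : Prop :=
  forall x y : pow2 Γ, {in s, x =1 y} -> C x -> C y.

Definition restrict (s : seq Γ) (x : pow2 Γ) : {ffun seq_sub s -> bool} :=
  [ffun u => x (val u)].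

(** Picks one representative of each pattern on [s]; a set determined by [s] contains all points
    with a given pattern or none. *)
Definition extend (s : seq Γ) (p : {ffun seq_sub s -> bool}) : pow2 Γ :=
  fun γ => if insub γ is Some u then p u else false.

Lemma extendE s (p : {ffun seq_sub s -> bool}) u : extend p (val u) = p u.
Proof. by rewrite /extend valK. Qed.

Lemma restrict_inE s x : {in s, extend (restrict s x) =1 x}.
Proof.
move=> γ γs; rewrite -[γ]/(val (SeqSub γs)).
by rewrite extendE ffunE.
Qed.

Lemma determined_by_restrict s C x :
  determined_by s C -> C (extend (restrict s x)) <-> C x.
Proof.
move=> sC; split; apply: sC => γ γs; first exact: restrict_inE.
by rewrite restrict_inE.
Qed.

Lemma measurable_coordinate (γ : Γ) (b : bool) :
  measurable [set x : pow2 Γ | x γ = b].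
Proof. by apply: sub_sigma_algebra; exists γ, b. Qed.

Lemma measurable_cylinder (s : seq Γ) (p : Γ -> bool) :
  measurable [set x : pow2 Γ | {in s, x =1 p}].
Proof.
rewrite (_ : [set x | _] = \bigcap_(γ in [set` s]) [set x : pow2 Γ | x γ = p γ]).
  apply: fin_bigcap_measurable; first exact: finite_seq.
  by move=> γ _; exact: measurable_coordinate.
by apply/seteqP; split=> x.
Qed.

Lemma restrict_eqE s p :
  [set x | restrict s x = p] = [set x : pow2 Γ | {in s, x =1 extend p}].
Proof.
apply/seteqP; split=> x /= => [<- γ γs|xp]; first by rewrite restrict_inE.
by apply/ffunP => u; rewrite ffunE xp ?extendE//; exact: valP.
Qed.

Lemma determined_byE s C : determined_by s C ->
  C = \bigcup_(p in [set` enum [pred p | `[< C (@extend s p) >]]])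
        [set x | restrict s x = p].
Proof.
move=> sC; apply/seteqP; split=> x.
  move=> Cx; exists (restrict s x) => //=; rewrite mem_enum inE.
  exact/(determined_by_restrict x sC).
move=> [p /=]; rewrite mem_enum inE /= => Cp xp.
by apply/(determined_by_restrict x sC); rewrite xp.
Qed.

Lemma measurable_determined_by s C : determined_by s C -> measurable C.
Proof.
move=> /determined_byE ->; apply: fin_bigcup_measurable.
  exact: finite_seq.
by move=> p _; rewrite restrict_eqE; exact: measurable_cylinder.
Qed.

Lemma coin_flip_determined_by (R : realType) (beta : probability (pow2 Γ) R)
    (s : seq Γ) C : coin_flip beta -> uniq s -> determined_by s C ->
  beta C = (#|[pred p | `[< C (@extend s p) >]]|%:R / 2 ^+ size s)%:E.
Proof.
move=> betaP us /determined_byE CE; rewrite {1}CE.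
rewrite measure_fin_bigcup; last 3 first.
- exact: finite_seq.
- by move=> p q _ _ [x [/= <- <-]].
- by move=> p _; rewrite restrict_eqE; exact: measurable_cylinder.
rewrite -fsbig_seq ?enum_uniq//= big_enum/=.
rewrite (eq_bigr (fun=> ((2^-1 : R) ^+ size s)%:E)); last first.
  by move=> p _; rewrite restrict_eqE -(betaP s (extend p) us).
by rewrite sumEFin sumr_const exprVn mulr_natl.
Qed.

End patterns.

(** * Uniqueness, shift invariance and finite approximation for the coin flip measure *)

Section coin_flip_measure.
Variable Γ : groupType.

Lemma determined_byC (s : seq Γ) C : determined_by s C -> determined_by s (~` C).
Proof.
by move=> sC x y xy; apply: contra_not; apply: sC => γ γs; rewrite xy.
Qed.

Lemma determined_byU (s t : seq Γ) C D :
  determined_by s C -> determined_by t D ->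
  determined_by (undup (s ++ t)) (C `|` D).
Proof.
move=> sC tD x y xy.
case=> [/(sC x y)|/(tD x y)] Cy; [left|right]; apply: Cy => γ γs;
  by apply: xy; rewrite mem_undup mem_cat γs ?orbT.
Qed.

Lemma determined_byI (s t : seq Γ) C D :
  determined_by s C -> determined_by t D ->
  determined_by (undup (s ++ t)) (C `&` D).
Proof.
move=> sC tD; rewrite -[_ `&` _]setCK setCI; apply: determined_byC.
by apply: determined_byU; exact: determined_byC.
Qed.

Lemma determined_by_coordinate (γ : Γ) b :
  determined_by [:: γ] [set x : pow2 Γ | x γ = b].
Proof. by move=> x y xy /= <-; rewrite xy ?inE. Qed.

(** The sets determined by finitely many coordinates are closed under intersection and generate the
    σ-algebra, and both measures are given on them by counting patterns. *)
Lemma coin_flip_unique (R : realType) (mu nu : probability (pow2 Γ) R) A :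
  coin_flip mu -> coin_flip nu -> measurable A -> mu A = nu A.
Proof.
move=> muP nuP; pose G C := exists2 s : seq Γ, uniq s & determined_by s C.
have GT : G setT by exists [::].
apply: (measure_unique G (fun=> setT)) => //.
- apply/seteqP; split; last first.
    apply: smallest_sub; first exact: sigma_algebra_measurable.
    by move=> C [s _ sC]; exact: measurable_determined_by sC.
  apply: sub_smallest2r; first exact: smallest_sigma_algebra.
  move=> _ [γ [b ->]]; exists [:: γ] => //; exact: determined_by_coordinate.
- move=> C D [s us sC] [t ut tD]; exists (undup (s ++ t)).
    exact: undup_uniq.
  exact: determined_byI.
- by apply/seteqP; split=> // x _; exists 0%N.
- move=> C [s us sC]; exact: etrans (coin_flip_determined_by muP us sC)
    (esym (coin_flip_determined_by nuP us sC)).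
- by move=> _; apply: le_lt_trans (probability_le1 mu measurableT) _; rewrite ltry.
Qed.

Lemma bernoulli_shift1 (x : pow2 Γ) : bernoulli_shift 1%g x = x.
Proof. by apply/funext => δ; rewrite /bernoulli_shift mulg1. Qed.

Lemma bernoulli_shiftM (γ δ : Γ) (x : pow2 Γ) :
  bernoulli_shift (γ * δ)%g x = bernoulli_shift γ (bernoulli_shift δ x).
Proof. by apply/funext => ε; rewrite /bernoulli_shift mulgA. Qed.

Lemma measurable_bernoulli_shift (σ : Γ) :
  measurable_fun [set: pow2 Γ] (bernoulli_shift σ).
Proof.
apply: (@measurability _ _ (pow2 Γ) (pow2 Γ) setT _ (@coordinate_sets Γ)) => //.
move=> _ [_ [γ [b ->]] <-]; rewrite setTI.
exact: (@measurable_coordinate _ (γ * σ)%g b).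
Qed.

HB.instance Definition _ (σ : Γ) := isMeasurableFun.Build _ _ _ _
  (bernoulli_shift σ) (measurable_bernoulli_shift σ).

(** The image measure is again a coin flip measure, because the preimage of a cylinder over [s] is a
    cylinder over the distinct coordinates γσ, γ in [s]. Uniqueness concludes. *)
Lemma coin_flip_bernoulli_shift (R : realType) (beta : probability (pow2 Γ) R)
    (σ : Γ) A : coin_flip beta -> measurable A ->
  beta (bernoulli_shift σ @^-1` A) = beta A.
Proof.
move=> betaP mA.
apply: (@coin_flip_unique _ (distribution beta (bernoulli_shift σ)) beta A) => //.
move=> s p us.
rewrite -(size_map (fun γ => γ * σ)%g s).
rewrite -(betaP _ (fun γ => p (γ * σ^-1)%g)); last first.
  by rewrite map_inj_uniq//; exact: mulIg.
congr (beta _); apply/seteqP; split=> x /= xp γ.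
  by move=> /mapP[δ δs ->]; rewrite mulgK -xp.
by move=> γs; rewrite /bernoulli_shift xp ?mulgK//; exact: map_f.
Qed.

(** The sets that can be approximated form a σ-algebra containing the coordinate sets. *)
Lemma determined_by_approx (R : realType) (beta : probability (pow2 Γ) R)
    A (e : R) : measurable A -> (0 < e)%R ->
  exists s C, [/\ uniq s, determined_by s C & beta (A `+` C) <= e%:E].
Proof.
pose P (A : set (pow2 Γ)) := measurable A /\ forall e : R, (0 < e)%R ->
  exists s C, [/\ uniq s, determined_by s C & beta (A `+` C) <= e%:E].
have mY (C D : set (pow2 Γ)) : measurable C -> measurable D -> measurable (C `+` D).
  by move=> mC mD; apply: measurableU; exact: measurableD.
have leP C D s F (e1 e2 : R) : measurable C -> measurable D -> determined_by s F ->
    beta (C `+` D) <= e1%:E -> beta (D `+` F) <= e2%:E ->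
    beta (C `+` F) <= (e1 + e2)%:E.
  move=> mC mD /measurable_determined_by mF CD DF.
  rewrite EFinD; apply: le_trans (leeD CD DF).
  apply: le_trans (measureU2 _ _ _); [|exact: mY|exact: mY].
  apply: le_measure; rewrite ?inE; [exact: mY|by apply: measurableU; exact: mY|].
  move=> x [[Cx Fx]|[Fx Cx]]; have [Dx|Dx] := pselect (D x).
  - by right; left.
  - by left; left.
  - by left; right.
  - by right; right.
have PU A1 A2 : P A1 -> P A2 -> P (A1 `|` A2).
  move=> [mA1 A1P] [mA2 A2P]; split; first exact: measurableU.
  move=> e' e'0; have e'2 : (0 < e' / 2)%R by rewrite divr_gt0.
  have [s1 [C1 [us1 sC1 A1C1]]] := A1P _ e'2.
  have [s2 [C2 [us2 sC2 A2C2]]] := A2P _ e'2.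
  have mC1 := measurable_determined_by sC1; have mC2 := measurable_determined_by sC2.
  exists (undup (s1 ++ s2)), (C1 `|` C2); split.
  - exact: undup_uniq.
  - exact: determined_byU.
  rewrite [e'](splitr e') EFinD; apply: le_trans (leeD A1C1 A2C2).
  apply: le_trans (measureU2 _ _ _); [|exact: mY|exact: mY].
  apply: le_measure; rewrite ?inE.
  - by apply: mY; exact: measurableU.
  - by apply: measurableU; exact: mY.
  - by move=> x; rewrite /setY/=; tauto.
have PUinf (B : nat -> set (pow2 Γ)) : (forall n, P (B n)) -> P (\bigcup_n B n).
  move=> PB; have mB n : measurable (B n) by case: (PB n).
  have mU : measurable (\bigcup_n B n) by exact: bigcupT_measurable.
  split=> // e' e'0; have e'2 : (0 < e' / 2)%R by rewrite divr_gt0.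
  (* The remainders [D n] of the partial unions decrease to the empty set, so by continuity from
     above one of them has measure at most half the error; the other half goes to approximating
     [V n]. *)
  pose V n := \bigcup_(i < n) B i; pose D n := (\bigcup_n B n) `\` V n.
  have PV n : P (V n).
    rewrite /V; elim: n => [|n IHn].
      rewrite II0 bigcup_set0; split=> // e'' e''0; exists [::], set0; split=> //.
      by rewrite setYK measure0 lee_fin ltW.
    by rewrite bigcup_mkord big_ord_recr/= -bigcup_mkord; exact: PU.
  have mV n : measurable (V n) by case: (PV n).
  have [n Dn] : exists n, beta (D n) <= (e' / 2)%:E.
    apply: contrapT => /forallNP ND.
    have D0 : \bigcap_n D n = set0.
      apply/seteqP; split=> // x DNx; have [[n _ Bx] _] := DNx 0%N I.
      by have [_] := DNx n.+1 I; apply; exists n => /=.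
    have cvgD : (beta \o D) n @[n --> \oo] --> beta (\bigcap_n D n).
      apply: nonincreasing_cvg_mu.
      - by rewrite ltey_eq fin_num_measure//; exact: measurableD.
      - by move=> n; exact: measurableD.
      - by rewrite D0.
      - move=> m n mn; apply/subsetPset => x [Ux Vx]; split=> // -[i /= im Bx].
        by apply: Vx; exists i => //=; exact: leq_trans im mn.
    have : (e' / 2)%:E <= lim ((beta \o D) n @[n --> \oo]).
      apply: lime_ge; first by apply/cvg_ex; eexists; exact: cvgD.
      by apply: nearW => n; have /negP := ND n; rewrite -ltNge => /ltW.
    by rewrite (cvg_lim _ cvgD)// D0 measure0 lee_fin leNgt e'2.
  have [_ /(_ _ e'2)[s [C [us sC VC]]]] := PV n.
  exists s, C; split=> //; rewrite [e'](splitr e').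
  apply: (leP _ _ s) VC => //.
  rewrite /setY (_ : V n `\` _ = set0) ?setU0//.
  by apply/seteqP; split=> // x [[i _ Bx]] []; exists i.
suff : @measurable _ (pow2 Γ) `<=` P by move=> mP /mP[_]; exact.
apply: smallest_sub; first split.
- split=> // e' e'0; exists [::], set0; split=> //.
  by rewrite setYK measure0 lee_fin ltW.
- move=> B [mB PB]; rewrite setTD; split; first exact: measurableC.
  move=> e' /PB[s [C [us sC BC]]]; exists s, (~` C); split=> //.
    exact: determined_byC.
  (* Complementing is adding [setT] in the group of sets under symmetric difference, so it
     cancels. *)
  by rewrite -!setTYC setYA (setYC _ setT) -!setYA setYA setYK set0Y.
- by move=> B PB; exact: PUinf.
- move=> _ [γ [b ->]]; split; first exact: measurable_coordinate.
  move=> e' e'0; exists [:: γ], [set x | x γ = b]; split=> //.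
    exact: determined_by_coordinate.
  by rewrite setYK measure0 lee_fin ltW.
Qed.

End coin_flip_measure.

(** * Pullbacks to a free action *)

Section pullback.
Context d (T : measurableType d) (Γ : groupType) (X : set T).
Context (act : Γ -> T -> T).
Hypotheses (mX : measurable X) (actP : borel_action X act).
Hypothesis act_free : free_action X act.
Context (J : countType) (U : J -> set T).
Hypotheses (mU : forall j, measurable (U j)) (sepU : point_separating U).
Context (F : set Γ).

(** Unlike independence in the Schreier graph of the free part, this constrains every point of 2^Γ
    and excludes σ = 1 instead of fixed points: a pullback may pass through points that are not
    free. *)
Definition locally_independent (E : set (pow2 Γ)) : Prop :=
  forall x σ, (F `|` [set τ^-1%g | τ in F]) σ -> σ <> 1%g -> E x ->
    ~ E (bernoulli_shift σ x).

(** The equivariant map X -> 2^Γ given by a 2-coloring [h] of the colors. It is used with colors at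
    most [N] on [X], where [inord] is faithful. *)
Let itinerary (N : nat) (c : T -> nat) (h : {ffun 'I_N.+1 -> bool}) (x : T) :
  pow2 Γ :=
  fun γ => h (inord (c (act γ x))).

Let measurable_itinerary N (c : T -> nat) (h : {ffun 'I_N.+1 -> bool}) :
  (forall j, measurable (X `&` c @^-1` [set j])) -> measurable_fun X (itinerary c h).
Proof.
move=> mc; apply: (@measurability _ _ T (pow2 Γ) X _ (@coordinate_sets Γ)) => //.
move=> _ [_ [γ [b ->]] <-].
rewrite (_ : _ `&` _ = X `&` act γ @^-1`
    \bigcup_(j in [set j | h (inord j) = b]) (X `&` c @^-1` [set j])).
  case: actP => _ _ _; apply => //.
  by apply: bigcup_measurable => j _; exact: mc.
have actX x : X x -> X (act γ x) by case: actP => + _ _ _; exact.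
apply/seteqP; split=> x [Xx /= xb]; split=> //.
  by exists (c (act γ x)) => //; split=> //; exact: actX.
by case: xb => j /= <- [_ /= <-].
Qed.

Let itineraryM N (c : T -> nat) (h : {ffun 'I_N.+1 -> bool}) σ x : X x ->
  itinerary c h (act σ x) = bernoulli_shift σ (itinerary c h x).
Proof.
move=> Xx; apply/funext => γ; rewrite /itinerary /bernoulli_shift.
by have [_ _ actM _] := actP; rewrite actM.
Qed.

(* A uniformly random 2-coloring [h] of the colors used by [c] makes the values
   [h (c (act γ x))], for [γ] in [s], independent fair coin flips, so the sets
   [E (itinerary c h x)] cover every [x] the same number of times. *)
Lemma pullback_colorable (s : seq Γ) (E : set (pow2 Γ)) :
  uniq s -> determined_by s E -> locally_independent E ->
  exists k l, [/\ kfold_colorable (schreier act X F) k l, (0 < l)%N &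
    (k * 2 ^ size s = #|[pred p | `[< E (@extend _ s p) >]]| * l)%N].
Proof.
move=> us sE indE.
have [N0 [c [mc cN0 cI]]] :=
  borel_coloring_injective mX actP act_free mU sepU s.
(* Adding [size s] makes [N.+1 - size s] below a genuine difference. *)
pose N := (N0 + size s)%N.
have cN x : X x -> (c x < N.+1)%N.
  by move=> /cN0 /leq_trans; apply; rewrite leqW// leq_addr.
have actX γ x : X x -> X (act γ x) by case: actP => + _ _ _; exact.
pose Q := [pred p | `[< E (@extend _ s p) >]].
pose L := {ffun 'I_N.+1 -> bool}.
have sizeL : #|{: L}| = (2 ^ N.+1)%N by rewrite card_ffun card_bool card_ord.
(* There is one independent set for each 2-coloring of the [N.+1] colors; each accepted pattern on
   [s] comes from [2 ^ (N.+1 - size s)] of them. *)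
exists (#|Q| * 2 ^ (N.+1 - size s))%N, #|{: L}|; split; last 2 first.
- by rewrite sizeL expn_gt0.
- by rewrite -mulnA -expnD subnK ?sizeL// leqW// leq_addl.
exists (fun i => X `&` itinerary c (enum_val i) @^-1` E); split.
- move=> i; apply: measurable_itinerary => //.
  exact: measurable_determined_by sE.
- move=> i; split=> [|x y]; first exact: subIsetl.
  move=> [Xx /= Ex] [_ /= Ey] [xy [σ Fσ yx]].
  move: Ey; rewrite yx itineraryM//; apply: indE => // σ1.
  by have [_ act1 _ _] := actP; apply: xy; rewrite yx σ1 act1.
- move=> x /= Xx.
  (* The points γ·x, γ in [s], have distinct colors, so [h] can be counted through its restriction
     along [k]. *)
  pose k (u : seq_sub s) : 'I_N.+1 := inord (c (act (val u) x)).
  have kI : injective k.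
    move=> u v /(congr1 val) /=; rewrite !inordK; [|exact/cN/actX|exact/cN/actX].
    move=> /cI uv; apply/val_inj/uv => //; exact: valP.
  have := card_ffun_precomp Q kI; rewrite card_seq_sub// card_ord.
  set P := [pred h | _] => cardQ.
  rewrite [leqRHS](_ : _ = #|P|).
    rewrite -(@leq_pmul2r (2 ^ size s)) ?expn_gt0// cardQ -mulnA -expnD subnK//.
    by rewrite leqW// leq_addl.
  rewrite -[LHS](fintype.card_image (@enum_val_inj _ _)); apply: eq_card => h.
  have QE : Q [ffun u => h (k u)] <-> E (itinerary c h x).
    rewrite -(determined_by_restrict (itinerary c h x) sE) inE /=.
    have -> // : [ffun u => h (k u)] = restrict s (itinerary c h x).
    by apply/ffunP => u; rewrite !ffunE.
  apply/fintype.imageP/idP => [[i + hE]|/QE Eh].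
    by rewrite inE /= -hE => -[_ /QE]; exact.
  exists (enum_rank h); last by rewrite enum_rankK.
  by rewrite inE /=; split=> //; rewrite enum_rankK.
Qed.

(** The pullbacks give a ratio l/k equal to 1/β(E). *)
Lemma borel_fractional_chromatic_le (R : realType)
    (beta : probability (pow2 Γ) R) (s : seq Γ) (E : set (pow2 Γ)) :
  coin_flip beta -> uniq s -> determined_by s E -> locally_independent E ->
  borel_fractional_chromatic R (schreier act X F) <= (beta E)^-1.
Proof.
move=> betaP us sE indE; rewrite (coin_flip_determined_by betaP us sE).
have [k [l [kl l0]]] := pullback_colorable us sE indE.
set q := #|_| => kq.
(* If [E] is null, the right side is the inverse of 0, which is [+oo]. *)
have [->|q0] := eqVneq q 0%N; first by rewrite mul0r inve0 leey.
have k0 : (0 < k)%N.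
  by move: q0 l0; rewrite -!lt0n => q0 l0; have := muln_gt0 q l; rewrite -kq
    muln_gt0 q0 l0 => /andP[].
apply: (@le_trans _ _ (l%:R%:E / k%:R%:E)).
  apply: (@le_trans _ _ (borel_kfold_chromatic R (schreier act X F) k / k%:R%:E)).
    by apply: ereal_inf_lbound; exists k.
  apply: lee_wpmul2r; first by rewrite inve_ge0 lee_fin.
  by apply: ereal_inf_lbound; exists l.
have kR : (k%:R != 0 :> R)%R by rewrite pnatr_eq0 -lt0n.
have qR : (q%:R != 0 :> R)%R by rewrite pnatr_eq0.
have sR : (2 ^+ size s != 0 :> R)%R by rewrite expf_neq0// pnatr_eq0.
rewrite !inver (negPf kR) mulf_eq0 invr_eq0 (negPf qR) (negPf sR)/=.
rewrite -EFinM lee_fin invf_div.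
rewrite ler_pdivrMr ?ltr0n// mulrAC -natrX -!natrM mulnC kq natrM mulrAC.
by rewrite divff// mul1r.
Qed.

End pullback.

(** * Comparison with the independence number *)

(** Approximate [I] by a finitely determined [C] and delete from [C] the points with a nontrivial
    translate in [C]. A point of [I] is lost only if it or such a translate lies where [I] and [C]
    may differ, which by shift invariance is rare. *)
Lemma locally_independent_approx (R : realType) (Γ : groupType) (F : set Γ)
    (beta : probability (pow2 Γ) R) (I : set (pow2 Γ)) (e : R) :
  finite_set F -> coin_flip beta -> mu_measurable beta I ->
  independent (schreier (@bernoulli_shift Γ) (free_part Γ) F) I -> (0 < e)%R ->
  exists s E, [/\ uniq s, determined_by s E, locally_independent F E &
    (beta^*)%mu I <= beta E + e%:E].
Proof.
move=> finF betaP [A mA [N [mN N0 AIN]]] [Ifree indI] e0.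
have [S SE] : exists S : seq Γ, F `|` [set τ^-1%g | τ in F] = [set` S].
  by apply/finite_seqP; rewrite finite_setU; split=> //; exact: finite_image.
(* The error is split among the identity and the elements of [S]. *)
pose n := (size S).+1.
have betaU (P Q : set (pow2 Γ)) : measurable P -> measurable Q ->
    beta (P `|` Q) <= beta P + beta Q by exact: measureU2.
have betaN : beta N = 0 by [].
have en0 : (0 < e / n%:R)%R by rewrite divr_gt0// ltr0n.
have [s [C [us sC AC]]] := determined_by_approx beta mA en0.
have mC := measurable_determined_by sC.
pose E := [set x | C x /\
  forall σ, σ \in S -> σ <> 1%g -> ~ C (bernoulli_shift σ x)].
(* The shift by σ reads coordinate γσ at γ. *)
pose t := undup (s ++ [seq (γ * σ)%g | γ <- s, σ <- S]).
have tE : determined_by t E.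
  move=> x y xy [Cx NCx]; split.
    by apply: sC Cx => γ γs; apply: xy; rewrite mem_undup mem_cat γs.
  move=> σ σS σ1; apply: contra_not (NCx σ σS σ1); apply: sC => γ γs.
  apply/esym/xy; rewrite mem_undup mem_cat; apply/orP; right.
  by apply/allpairsP; exists (γ, σ).
have mE := measurable_determined_by tE.
exists t, E; split=> //.
- exact: undup_uniq.
- move=> x σ; rewrite SE /= => σS σ1 [_ NCx] [Cσx _].
  exact: NCx σS σ1 Cσx.
(* Outside [B] the sets [I], [A] and [C] agree. *)
pose B := (A `+` C) `|` N.
have mB : measurable B.
  by apply: measurableU => //; apply: measurableU; exact: measurableD.
have betaB : beta B <= (e / n%:R)%:E.
  apply: le_trans (betaU _ _ _ _) _ => //.
    by apply: measurableU; exact: measurableD.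
  by rewrite betaN adde0.
have mBσ σ : measurable (bernoulli_shift σ @^-1` B).
  by rewrite -[X in measurable X]setTI; exact: measurable_bernoulli_shift.
pose D (S' : seq Γ) := \big[setU/set0]_(σ <- S') (bernoulli_shift σ @^-1` B).
have mD S' : measurable (D S') by apply: bigsetU_measurable.
have betaD S' : beta (D S') <= (e / n%:R *+ size S')%:E.
  elim: S' => [|σ S' IHS']; first by rewrite /D big_nil measure0.
  rewrite /D big_cons -/(D S') /= mulrS EFinD.
  apply: le_trans (betaU _ _ _ _) _ => //.
  by apply: leeD => //; rewrite coin_flip_bernoulli_shift.
have IS : I `<=` E `|` D (1%g :: S).
  move=> x Ix; rewrite /D -bigcup_seq.
  have [Bx|NBx] := pselect (B x).
    by right; exists 1%g; rewrite /= ?inE ?eqxx//= bernoulli_shift1.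
  have Ax : A x by apply: contrapT => NAx; apply: NBx; right; apply: AIN; right.
  have Cx : C x by apply: contrapT => NCx; apply: NBx; left; left.
  have [[σ [σS σ1 Cσx]]|NCσ] := pselect (exists σ, [/\ σ \in S, σ <> 1%g &
      C (bernoulli_shift σ x)]); last first.
    by left; split=> // σ σS σ1 Cσx; apply: NCσ; exists σ.
  right; exists σ; first by rewrite /= inE σS orbT.
  apply: contrapT => /= NBσx.
  have Aσx : A (bernoulli_shift σ x).
    by apply: contrapT => NAx; apply: NBσx; left; right.
  have Iσx : I (bernoulli_shift σ x).
    by apply: contrapT => NIx; apply: NBσx; right; apply: AIN; left.
  (* Adjacency requires distinct points; this is where freeness of [x] turns σ ≠ 1 into σ·x ≠ x. *)
  apply: (indI _ _ Ix Iσx); split.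
    by move=> /esym /(Ifree _ Ix) /σ1.
  by exists σ; rewrite // SE.
apply: (@le_trans _ _ (beta (E `|` D (1%g :: S)))).
  rewrite -measurable_mu_extE; first exact: le_mu_ext.
  exact: measurableU.
apply: le_trans (betaU _ _ _ _) _ => //; apply: leeD => //.
by apply: le_trans (betaD _) _; rewrite -mulr_natr divfK// pnatr_eq0.
Qed.

Lemma borel_fractional_chromatic_ge0 (R : realType) d (T : measurableType d)
    (G : graph T) : 0 <= borel_fractional_chromatic R G.
Proof.
apply: le_ereal_inf_tmp => _ [k _ <-]; apply: mule_ge0;
  last by rewrite inve_ge0 lee_fin.
by apply: le_ereal_inf_tmp => _ [l _ <-]; rewrite lee_fin.
Qed.

Section main_inequality.
Context (R : realType) (Γ : groupType) (F : set Γ).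
Hypothesis finF : finite_set F.
Context (beta : probability (pow2 Γ) R).
Hypothesis betaP : coin_flip beta.
Let G := schreier (@bernoulli_shift Γ) (free_part Γ) F.

Lemma independence_number_ge0 : 0 <= independence_number beta G.
Proof.
apply: ereal_sup_ubound; exists set0; last by rewrite mu_ext0.
split; last by split.
exists set0 => //; rewrite setYK; exact: negligible_set0.
Qed.

(** Passing to inverses turns the claim into α ≤ 1/χ, where the supremum and an additive error can
    be handled and α = 0 is no exception. *)
Lemma borel_fractional_chromatic_le_inv d (T : measurableType d) (X : set T)
    (act : Γ -> T -> T) (J : countType) (U : J -> set T) :
  measurable X -> borel_action X act -> free_action X act ->
  (forall j, measurable (U j)) -> point_separating U ->
  borel_fractional_chromatic R (schreier act X F) <=
    (independence_number beta G)^-1.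
Proof.
move=> mX actP act_free mU sepU; set χ := borel_fractional_chromatic _ _.
have χ0 : 0 <= χ by exact: borel_fractional_chromatic_ge0.
rewrite inve_pge ?inE ?independence_number_ge0//.
apply: ge_ereal_sup => _ [I [mI indI] <-]; apply/lee_addgt0Pr => e e0.
have [s [E [us sE indE Ile]]] := locally_independent_approx finF betaP mI indI e0.
apply: (le_trans Ile); apply: leeD => //.
rewrite inve_pge ?inE ?measure_ge0//.
exact: borel_fractional_chromatic_le betaP us sE indE.
Qed.

Lemma measurable_free_part : countable [set: Γ] -> measurable (free_part Γ).
Proof.
move=> Γc; pose stable γ := [set x : pow2 Γ | bernoulli_shift γ x = x].
have mstable γ : measurable (stable γ).
  rewrite (_ : stable γ =
      ~` \bigcup_δ ~` [set x : pow2 Γ | x (δ * γ)%g = x δ]).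
    apply: measurableC; apply: countable_bigcupT_measurable => // δ.
    apply: (@measurable_determined_by _ [:: (δ * γ)%g; δ]).
    by apply: determined_byC => x y xy /=; rewrite -!xy ?inE ?eqxx ?orbT.
  rewrite setC_bigcup; apply/seteqP; split=> x /= => [xγ δ _|xγ].
    by rewrite setCK /= -[in RHS]xγ.
  by apply/funext => δ; have := xγ δ Logic.I; rewrite setCK.
rewrite (_ : free_part Γ = ~` \bigcup_γ (if γ == 1%g then set0 else stable γ)).
  apply: measurableC; apply: countable_bigcupT_measurable => // γ.
  by case: ifP.
rewrite setC_bigcup; apply/seteqP; split=> x xP γ.
  by move=> _; case: eqP => [_ []|γ1 /xP /γ1].
by move=> xγ; have := xP γ Logic.I; case: eqP => // _; apply.
Qed.

(** Integrating the number of sets that cover a point over the free part, which has measure 1, gives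
    k ≤ ∑ β(I_i) ≤ lα. *)
Lemma borel_fractional_chromatic_ge_inv :
  measurable (free_part Γ) -> beta (free_part Γ) = 1 ->
  (independence_number beta G)^-1 <= borel_fractional_chromatic R G.
Proof.
move=> mfree beta_free.
have α0 := independence_number_ge0.
have betaα I : measurable I -> independent G I ->
    beta I <= independence_number beta G.
  move=> mI indI; apply: ereal_sup_ubound; exists I; last exact: measurable_mu_extE.
  by split=> //; exists I => //; rewrite setYK; exact: negligible_set0.
have kα k l : kfold_colorable G k l ->
    k%:R%:E <= l%:R%:E * independence_number beta G.
  move=> [I [mI indI covI]].
  apply: (@le_trans _ _ (\int[beta]_(x in free_part Γ) (k%:R%:E : \bar R))).
    by rewrite integral_cst// [X in _ * X](_ : _ = 1) ?mule1.
  apply: (@le_trans _ _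
    (\int[beta]_(x in free_part Γ) \sum_(i < l) (\1_(I i) x)%:E)).
    apply: ge0_le_integral => //.
    - apply: emeasurable_sum => i; apply/measurable_EFinP.
      exact: measurable_indic.
    - move=> x /covI kx; rewrite sumEFin lee_fin.
      apply: (@le_trans _ _ (#|[pred i | x \in I i]|%:R)); first by rewrite ler_nat.
      rewrite -sum1_card natr_sum big_mkcond/=; apply: ler_sum => i _.
      by rewrite indicE inE; case: ifP.
  rewrite ge0_integral_sum//; last first.
    move=> i; apply/measurable_EFinP.
    exact: measurable_indic.
  apply: (@le_trans _ _ (\sum_(i < l) independence_number beta G)).
    apply: lee_sum => i _; rewrite integral_indic// setIidl.
      exact: betaα.
    by case: (indI i).
  by rewrite sumr_const card_ord mule_natl.
have α1 : independence_number beta G <= 1.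
  apply: ge_ereal_sup => _ [I _ <-]; rewrite -(@probability_setT _ _ _ beta).
  rewrite -measurable_mu_extE//; exact: le_mu_ext.
case: (independence_number beta G) α0 α1 kα => [a| |]//.
rewrite !lee_fin => a0 a1 kα.
apply: le_ereal_inf_tmp => _ [k /= k1 <-].
have k0 : (0 < k%:R :> R)%R by rewrite ltr0n.
rewrite [X in _ * X]inver gt_eqF// lee_pdivlMr//.
apply: le_ereal_inf_tmp => _ [l /kα kl <-].
move: kl; rewrite -EFinM lee_fin => kl.
(* A k-fold coloring is at hand here, so k ≤ la with k ≥ 1 excludes a = 0, whose inverse would be
   [+oo]. *)
have a_gt0 : (0 < a)%R.
  rewrite lt_def a0 andbT; apply/eqP => a_eq0.
  by move: kl; rewrite a_eq0 mulr0 leNgt k0.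
by rewrite inver gt_eqF// -EFinM lee_fin mulrC ler_pdivrMr.
Qed.

End main_inequality.

(** * Countable separating families and the conclusion *)

Lemma standard_borel_separating (R : realType) d (T : measurableType d) :
  standard_borel R T ->
  exists2 U : nat * nat -> set T, forall j, measurable (U j) & point_separating U.
Proof.
move=> [Y [[[D /countable_injP[g gI] denseD] _] [f [f' fK _] fP]]].
(* At most one [q] has a given code, so this union is the interior of one ball, or empty. *)
pose U (j : nat * nat) := f @^-1` \bigcup_(q in [set q | D q /\ g q = j.1])
  (ball q (j.2.+1%:R^-1 : R))°.
exists U => [j|x y xy].
  apply/fP; eexists; last by [].
  apply: sub_sigma_algebra; apply: bigcup_open => q _; exact: open_interior.
have xy0 : (0 < mdist (f x) (f y) :> R)%R.
  rewrite lt_def mdist_ge0 andbT; apply/eqP => /mdist_positivity fxy.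
  by apply: xy; rewrite -(fK x) fxy fK.
(* A ball of radius 1/(n+1) is then too small to contain both [f x] and [f y]. *)
have [n nxy] : exists n, (n.+1%:R^-1 + n.+1%:R^-1 < mdist (f x) (f y) :> R)%R.
  have xy2 : (0 < mdist (f x) (f y) / 2 :> R)%R by rewrite divr_gt0.
  have [n _ nP] := near_infty_natSinv_lt (PosNum xy2).
  exists n; rewrite [ltRHS](splitr (mdist _ _)).
  by apply: ltrD; exact: (nP n (leqnn n)).
have n0 : (0 < n.+1%:R^-1 :> R)%R by rewrite invr_gt0.
have n20 : (0 < n.+1%:R^-1 / 2 :> R)%R by rewrite divr_gt0.
(* Half the radius, so that a whole ball around [f x] fits into the ball around [q]. *)
have [q [Dq xq]] : D `&` (ball (f x) (n.+1%:R^-1 / 2 : R))° !=set0.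
  rewrite setIC; apply: denseD; last exact: open_interior.
  by exists (f x); exact: nbhsx_ballx.
exists (g q, n).
  exists q => //=; apply: (@filterS _ _ _ (ball (f x) (n.+1%:R^-1 / 2 : R)));
    last exact: nbhsx_ballx.
  move=> z xz; rewrite [X in ball _ X](splitr n.+1%:R^-1).
  by apply: ball_triangle xz; apply: ball_sym; exact: interior_subset xq.
move=> [q' [Dq' /= gq']] /interior_subset.
have -> : q' = q by apply: gI; rewrite ?inE.
move=> yq; have : ball (f x) (n.+1%:R^-1 + n.+1%:R^-1 : R) (f y).
  apply: ball_triangle yq; apply: le_ball (interior_subset xq).
  by rewrite ler_pdivrMr// ler_peMr ?ler1n// ltW.
by rewrite ballEmdist /= ltNge => /negP; apply; exact: ltW.
Qed.

(** The coordinate sets separate points; they are indexed by codes in [nat] because [Γ] is not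
    itself a [countType]. *)
Lemma pow2_separating (Γ : groupType) : countable [set: Γ] ->
  exists2 U : nat * bool -> set (pow2 Γ),
    forall j, measurable (U j) & point_separating U.
Proof.
move=> Γc; have /countable_injP[g gI] := Γc.
exists (fun j =>
    \bigcup_γ (if g γ == j.1 then [set x : pow2 Γ | x γ = j.2] else set0)).
  move=> j; apply: countable_bigcupT_measurable => // γ.
  by case: ifP => // _; exact: measurable_coordinate.
move=> x y xy; have [γ xyγ] : exists γ, x γ <> y γ.
  by apply: contrapT => /forallNP xyP; apply/xy/funext => γ;
    apply: contrapT; exact: xyP.
exists (g γ, x γ); first by exists γ => //=; rewrite eqxx.
move=> [δ _] /=; case: eqP => // /gI; rewrite !inE => /(_ I I) -> yγ.
exact: xyγ.
Qed.

Lemma borel_action_bernoulli_shift (Γ : groupType) :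
  borel_action (free_part Γ) (@bernoulli_shift Γ).
Proof.
split=> [γ x freex δ xδ|x _||γ]; [|by rewrite bernoulli_shift1|
  by move=> *; rewrite bernoulli_shiftM|].
  (* If δ fixes γ·x, its conjugate γ⁻¹δγ fixes [x]. *)
  have /freex : bernoulli_shift (γ^-1 * δ * γ)%g x = x.
    by rewrite 2!bernoulli_shiftM xδ -bernoulli_shiftM mulVg bernoulli_shift1.
  move=> /(congr1 (fun z => γ * z * γ^-1)%g).
  by rewrite mulg1 divgg !mulgA divgg mul1g mulgK.
apply: measurable_funS (@measurable_bernoulli_shift Γ γ) => //.
Qed.

Theorem theorem1p1 (R : realType) (Γ : groupType)
    (Γcountable : countable [set: Γ])
    (F : set Γ) (Ffinite : finite_set F)
    (beta : probability (pow2 Γ) R) (betaP : coin_flip beta)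
    (beta_free : beta (free_part Γ) = 1) :
  (forall (d : measure_display) (T : measurableType d) (X : set T)
      (act : Γ -> T -> T),
    standard_borel R T -> measurable X ->
    borel_action X act -> free_action X act ->
    borel_fractional_chromatic R (schreier act X F) <=
      (independence_number beta (schreier (@bernoulli_shift Γ) (free_part Γ) F))^-1) /\
  borel_fractional_chromatic R (schreier (@bernoulli_shift Γ) (free_part Γ) F) =
    (independence_number beta (schreier (@bernoulli_shift Γ) (free_part Γ) F))^-1.
Proof.
have mfree := measurable_free_part Γcountable.
split=> [d T X act sbT mX actP act_free|].
  have [U mU sepU] := standard_borel_separating sbT.
  exact: borel_fractional_chromatic_le_inv mU sepU.
apply/eqP; rewrite eq_le; apply/andP; split.
  (* On 2^Γ the coordinate sets take the place of a Polish topology. *)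
  have [U mU sepU] := pow2_separating Γcountable.
  apply: borel_fractional_chromatic_le_inv mU sepU => //.
    exact: borel_action_bernoulli_shift.
  by move=> γ x; exact.
exact: borel_fractional_chromatic_ge_inv.
Qed.
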